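(* Let $(X,r)$ be an involutive (non-degenerate, set-theoretic) solution to the Yang--Baxter equation with $|X|\leq 7$ that is not a multipermutation solution. Then the structure group $G(X,r)$ does not have the unique product property.
   Context: A solution is a pair $(X,r)$ where $X$ is a non-empty set and $r\colon X\times X\to X\times X$ is a bijective map, written $r(x,y)=(\sigma_x(y),\tau_y(x))$, such that $(r\times\mathrm{id})(\mathrm{id}\times r)(r\times\mathrm{id})=(\mathrm{id}\times r)(r\times\mathrm{id})(\mathrm{id}\times r)$ and all maps $\sigma_x,\tau_x\colon X\to X$ are permutations (non-degeneracy). It is involutive if $r^2=\mathrm{id}$. The size of $(X,r)$ is $|X|$. The structure group $G(X,r)$ is the group with generators the elements $x\in X$ and relations $x\circ y=u\circ v$ whenever $r(x,y)=(u,v)$. For an involutive solution $(X,r)$, write $x\sim y$ if and only if $\sigma_x=\sigma_y$. This equivalence relation induces a solution $\operatorname{Ret}(X,r)$ on the set $X/{\sim}$, given by $([x],[y])\mapsto([\sigma_x(y)],[\tau_y(x)])$. Define $\operatorname{Ret}^1(X,r)=\operatorname{Ret}(X,r)$ and $\operatorname{Ret}^{n+1}(X,r)=\operatorname{Ret}(\operatorname{Ret}^n(X,r))$ for $n\geq1$. The solution $(X,r)$ is a multipermutation solution if there exists $n$ such that $\operatorname{Ret}^n(X,r)$ has only one element. A group $G$ has the unique product property if for all finite non-empty subsets $A$ and $B$ of $G$ there exists $x\in G$ that can be written uniquely as $x=ab$ with $a\in A$ and $b\in B$. *)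

(* Defs.v *)
From HB Require Import structures.
From mathcomp Require Import all_boot.
From mathcomp Require Import boolp.
From mathcomp Require Import finmap.

Set Implicit Arguments.
Unset Strict Implicit.
Unset Printing Implicit Defensive.

Local Open Scope quotient_scope.
Local Open Scope group_scope.

Section Solutions.
Variables (X : Type) (r : X * X -> X * X).

(* r (x, y) = (sigma x y, tau y x) *)
Definition sigma (x y : X) : X := (r (x, y)).1.
Definition tau (y x : X) : X := (r (x, y)).2.

(* r12 = r x id and r23 = id x r on X * X * X *)
Definition r12 (t : X * X * X) : X * X * X := (r t.1, t.2).
Definition r23 (t : X * X * X) : X * X * X :=
  (t.1.1, (r (t.1.2, t.2)).1, (r (t.1.2, t.2)).2).

Definition yang_baxter : Prop := r12 \o r23 \o r12 =1 r23 \o r12 \o r23.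

Definition nondegenerate : Prop :=
  (forall x, bijective (sigma x)) /\ (forall x, bijective (tau x)).

Definition is_solution : Prop :=
  [/\ inhabited X, bijective r, yang_baxter & nondegenerate].

Definition is_involutive_solution : Prop := is_solution /\ involutive r.

End Solutions.

(* A set with a map X * X -> X * X, bundled so that Ret, which changes the
   carrier, can be iterated. *)
Record qset := QSet { qcarrier :> choiceType;
                      qmap : qcarrier * qcarrier -> qcarrier * qcarrier }.

Section Retraction.
Variable S : qset.

Definition ret_rel (x y : S) : bool :=
  `[< sigma (@qmap S) x = sigma (@qmap S) y >].

Lemma ret_rel_refl : reflexive ret_rel.
Proof. by move=> x; apply/asboolP. Qed.

Lemma ret_rel_sym : symmetric ret_rel.
Proof. by move=> x y; apply/asboolP/asboolP=> ->. Qed.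

Lemma ret_rel_trans : transitive ret_rel.
Proof. by move=> y x z /asboolP xy /asboolP yz; apply/asboolP; rewrite xy. Qed.

Canonical ret_equiv := EquivRel ret_rel ret_rel_refl ret_rel_sym ret_rel_trans.

Definition ret_carrier : choiceType := {eq_quot ret_rel}.

Definition ret_class (x : S) : ret_carrier := \pi_({eq_quot ret_rel}) x.

(* Defined on representatives; [ret_mapE] shows that the choice of
   representatives is irrelevant when S is an involutive solution. *)
Definition ret_map (p : ret_carrier * ret_carrier) :
    ret_carrier * ret_carrier :=
  let x := repr p.1 in let y := repr p.2 in
  (ret_class (sigma (@qmap S) x y), ret_class (tau (@qmap S) y x)).

Definition Ret : qset := QSet ret_map.

End Retraction.

Definition one_element (T : Type) : Prop := exists x : T, forall y : T, y = x.

(* Ret^n(X, r) is iter n Ret (X, r). *)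
Definition multipermutation (X : choiceType) (r : X * X -> X * X) : Prop :=
  exists n : nat, (0 < n)%N /\ one_element (iter n Ret (QSet r)).

Lemma inj_surj_bij (A B : Type) (f : A -> B) :
  injective f -> (forall b, exists a, f a = b) -> bijective f.
Proof.
move=> fI /(_ _)/cid fS; exists (fun b => sval (fS b)) => [a|b].
  by apply: fI; rewrite (svalP (fS (f a))).
exact: svalP (fS b).
Qed.

(* Applied below to (sigma, tau) and, by symmetry, to (tau, sigma). *)
Section Mirror.
Variables (X : Type) (s t : X -> X -> X).
Hypotheses (s_bij : forall x, bijective (s x)) (t_bij : forall x, bijective (t x)).
Hypotheses (sK : forall x y, s (s x y) (t y x) = x).
Hypothesis ss : forall x y z, s (s x y) (s (t y x) z) = s x (s y z).

Lemma diag_t x d : s x d = x -> t d x = d.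
Proof.
by move=> sxd; apply: (bij_inj (s_bij x)); rewrite -{1}sxd sK sxd.
Qed.

Lemma diag_tau x y d e : s x d = x -> s (t y x) e = t y x -> s y e = d.
Proof.
by move=> sd se; apply: (bij_inj (s_bij x)); rewrite -ss se sK sd.
Qed.

Lemma s_eq_t_eq x y : s x = s y -> t x = t y.
Proof.
move=> exy; apply: funext => z.
have diag w : exists d, s w d = w.
  by have [f _ fK] := s_bij w; exists (f w); rewrite fK.
have [d sd] := diag z.
have [e se] := diag (t x z); have [e' se'] := diag (t y z).
have ee' : e = e'.
  by apply: (bij_inj (s_bij x)); rewrite (diag_tau sd se) exy (diag_tau sd se').
rewrite -{}ee' in se'; apply: (bij_inj (t_bij e)).
by rewrite (diag_t se) (diag_t se').
Qed.

Lemma s_compat x y y' : s y = s y' -> s (s x y) = s (s x y').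
Proof.
move=> eyy; have et := s_eq_t_eq eyy; apply: funext => z.
have [f _ fK] := s_bij (t y x).
by rewrite -(fK z) ss et ss eyy.
Qed.

End Mirror.

Section RetractionFacts.
Variable S : qset.
Notation r := (@qmap S).
Notation s := (sigma r).
Notation t := (tau r).
Notation pi := (@ret_class S).
Hypothesis solS : is_involutive_solution r.

Let rK : involutive r. Proof. by case: solS. Qed.

Let s_bij x : bijective (s x).
Proof. by case: solS => -[_ _ _ [h _]] _; apply: h. Qed.

Let t_bij x : bijective (t x).
Proof. by case: solS => -[_ _ _ [_ h]] _; apply: h. Qed.

Let rE x y : r (x, y) = (s x y, t y x).
Proof. exact: surjective_pairing. Qed.

Let sK x y : s (s x y) (t y x) = x.
Proof. by rewrite {1}/sigma -rE rK. Qed.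

Let tK x y : t (t y x) (s x y) = y.
Proof. by rewrite {1}/tau -rE rK. Qed.

Let ybe x y z : r12 r (r23 r (r12 r (x, y, z))) = r23 r (r12 r (r23 r (x, y, z))).
Proof. by case: solS => -[_ _ h _] _; apply: (h (x, y, z)). Qed.

Let ss x y z : s (s x y) (s (t y x) z) = s x (s y z).
Proof. exact: (congr1 (fun p => p.1.1) (ybe x y z)). Qed.

Let tt x y z : t (t x y) (t (s y x) z) = t x (t y z).
Proof. exact: (esym (congr1 snd (ybe z y x))). Qed.

Let tK' x y : t (t x y) (s y x) = x.
Proof. exact: tK. Qed.

Lemma sigma_tau_eq x y : s x = s y <-> t x = t y.
Proof.
split; first exact: (s_eq_t_eq s_bij t_bij sK ss).
exact: (s_eq_t_eq t_bij s_bij tK' tt).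
Qed.

Lemma sigma_compat x y y' : s y = s y' -> s (s x y) = s (s x y').
Proof. exact: (s_compat s_bij t_bij sK ss). Qed.

Lemma tau_compat x x' y : s x = s x' -> s (t y x) = s (t y x').
Proof.
move=> /sigma_tau_eq exx; apply/sigma_tau_eq.
exact: (s_compat t_bij s_bij tK' tt).
Qed.

Lemma ret_classP x y : pi x = pi y <-> s x = s y.
Proof. by split=> [/eqmodP/asboolP // | h]; apply/eqmodP/asboolP. Qed.

Lemma ret_class_surj (a : Ret S) : exists x, pi x = a.
Proof. by exists (repr a); rewrite /ret_class reprK. Qed.

Lemma ret_mapE x y : ret_map (pi x, pi y) = (pi (s x y), pi (t y x)).
Proof.
have ex : s (repr (pi x)) = s x by apply/ret_classP; rewrite /ret_class reprK.
have ey : s (repr (pi y)) = s y by apply/ret_classP; rewrite /ret_class reprK.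
rewrite /ret_map /=; congr pair; apply/ret_classP.
  by rewrite ex; apply: sigma_compat.
by rewrite (iffLR (sigma_tau_eq _ _) ey); apply: tau_compat.
Qed.

Lemma Ret_involutive_solution : is_involutive_solution (@qmap (Ret S)).
Proof.
have retE x y : @qmap (Ret S) (pi x, pi y) = (pi (s x y), pi (t y x)).
  exact: ret_mapE.
have sE x y : sigma (@qmap (Ret S)) (pi x) (pi y) = pi (s x y).
  exact: (congr1 fst (ret_mapE x y)).
have tE x y : tau (@qmap (Ret S)) (pi y) (pi x) = pi (t y x).
  exact: (congr1 snd (ret_mapE x y)).
have retK : involutive (@qmap (Ret S)).
  move=> [a b]; have [x <-] := ret_class_surj a.
  have [y <-] := ret_class_surj b.
  by rewrite (retE x y) retE sK tK.
split; last exact: retK.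
split.
- by case: solS => -[[x] _ _ _] _; exact: (inhabits (pi x)).
- by exists (@qmap (Ret S)).
- move=> [[a b] c]; have [x <-] := ret_class_surj a.
  have [y <-] := ret_class_surj b; have [z <-] := ret_class_surj c.
  have r12E u v w : r12 (@qmap (Ret S)) (pi u, pi v, pi w) =
      (pi (s u v), pi (t v u), pi w) by rewrite /r12 retE.
  have r23E u v w : r23 (@qmap (Ret S)) (pi u, pi v, pi w) =
      (pi u, pi (s v w), pi (t w v)) by rewrite /r23 retE.
  rewrite /comp (r12E x y z) (r23E (s x y)) (r12E (s x y)).
  rewrite (r23E x y z) (r12E x) (r23E (s x (s y z))).
  exact: (congr1 (fun p => (pi p.1.1, pi p.1.2, pi p.2)) (ybe x y z)).
split=> a; have [x <-] := ret_class_surj a; apply: inj_surj_bij.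
- move=> b c; have [y <-] := ret_class_surj b; have [z <-] := ret_class_surj c.
  rewrite !sE => /ret_classP e; apply/ret_classP.
  have v : t y x = t z x.
    by apply: (bij_inj (s_bij (s x y))); rewrite sK e sK.
  by rewrite -(tK x y) -(tK x z) v; apply: tau_compat.
- move=> b; have [y <-] := ret_class_surj b; have [f _ fK] := s_bij x.
  by exists (pi (f y)); rewrite sE fK.
- move=> b c; have [y <-] := ret_class_surj b; have [z <-] := ret_class_surj c.
  rewrite !tE => /ret_classP e; apply/ret_classP.
  have v : s y x = s z x.
    apply: (bij_inj (t_bij (t x y))).
    by rewrite tK (iffLR (sigma_tau_eq _ _) e) tK.
  by rewrite -(sK y x) -(sK z x) v; apply: sigma_compat.
- move=> b; have [y <-] := ret_class_surj b; have [f _ fK] := t_bij x.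
  by exists (pi (f y)); rewrite tE fK.
Qed.

End RetractionFacts.

(* Words in the letters (true, x) for x and (false, x) for x^-1. *)
Definition word (X : Type) := seq (bool * X).

Definition word_inv (X : Type) (w : word X) : word X :=
  rev [seq (~~ l.1, l.2) | l <- w].

(* The least congruence containing rel and free cancellation. *)
Inductive pres_eq (X : Type) (rel : word X -> word X -> Prop) :
    word X -> word X -> Prop :=
| pres_rel u v : rel u v -> pres_eq rel u v
| pres_cancel b x : pres_eq rel [:: (b, x); (~~ b, x)] [::]
| pres_refl u : pres_eq rel u u
| pres_sym u v : pres_eq rel u v -> pres_eq rel v u
| pres_trans u v w : pres_eq rel u v -> pres_eq rel v w -> pres_eq rel u w
| pres_cat u u' v v' :
    pres_eq rel u u' -> pres_eq rel v v' -> pres_eq rel (u ++ v) (u' ++ v').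

Section Presentation.
Variables (X : choiceType) (rel : word X -> word X -> Prop).

Definition pres_eqb (u v : word X) : bool := `[< pres_eq rel u v >].

Lemma pres_eqb_refl : reflexive pres_eqb.
Proof. by move=> u; apply/asboolP; apply: pres_refl. Qed.

Lemma pres_eqb_sym : symmetric pres_eqb.
Proof. by move=> u v; apply/asboolP/asboolP; apply: pres_sym. Qed.

Lemma pres_eqb_trans : transitive pres_eqb.
Proof.
move=> v u w /asboolP uv /asboolP vw; apply/asboolP; exact: pres_trans uv vw.
Qed.

Canonical pres_equiv :=
  EquivRel pres_eqb pres_eqb_refl pres_eqb_sym pres_eqb_trans.

Definition presented : Type := {eq_quot pres_eqb}.

HB.instance Definition _ := Choice.on presented.

Definition pres_class (w : word X) : presented := \pi_({eq_quot pres_eqb}) w.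

Lemma pres_classP u v : pres_class u = pres_class v <-> pres_eq rel u v.
Proof. by split=> [/eqmodP/asboolP // | h]; apply/eqmodP/asboolP. Qed.

Lemma pres_class_surj (g : presented) : exists w, pres_class w = g.
Proof. by exists (repr g); rewrite /pres_class reprK. Qed.

Definition pres_repr (g : presented) : word X := repr g.

Lemma pres_reprP w : pres_eq rel (pres_repr (pres_class w)) w.
Proof. by apply/pres_classP; rewrite /pres_class reprK. Qed.

Definition pres_mul (g h : presented) : presented :=
  pres_class (pres_repr g ++ pres_repr h).

Definition pres_inv (g : presented) : presented :=
  pres_class (word_inv (pres_repr g)).

Lemma word_inv_cat (u v : word X) : word_inv (u ++ v) = word_inv v ++ word_inv u.
Proof. by rewrite /word_inv map_cat rev_cat. Qed.

Lemma word_invK : involutive (@word_inv X).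
Proof.
move=> w; rewrite /word_inv map_rev revK -map_comp -[RHS]map_id.
by apply: eq_map => -[b x] /=; rewrite negbK.
Qed.

Lemma word_mulV (w : word X) : pres_eq rel (w ++ word_inv w) [::].
Proof.
elim: w => [|[b x] w IHw]; first exact: pres_refl.
rewrite -cat1s word_inv_cat -catA (catA w).
apply: pres_trans (pres_cancel rel b x).
apply: (@pres_cat _ _ _ [:: (b, x)]); first exact: pres_refl.
by apply: (pres_cat IHw); apply: pres_refl.
Qed.

Lemma word_mulVl (w : word X) : pres_eq rel (word_inv w ++ w) [::].
Proof. by rewrite -{2}(word_invK w); apply: word_mulV. Qed.

Lemma pres_mulE u v :
  pres_mul (pres_class u) (pres_class v) = pres_class (u ++ v).
Proof. by apply/pres_classP; apply: pres_cat; apply: pres_reprP. Qed.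

Lemma word_inv_compat u v :
  pres_eq rel u v -> pres_eq rel (word_inv u) (word_inv v).
Proof.
move=> uv; apply: (@pres_trans _ _ _ (word_inv u ++ (v ++ word_inv v))).
  rewrite -{1}(cats0 (word_inv u)); apply: pres_cat; first exact: pres_refl.
  by apply: pres_sym; apply: word_mulV.
rewrite catA -[X in pres_eq _ _ X]cat0s; apply: pres_cat; last exact: pres_refl.
apply: pres_trans (word_mulVl u).
by apply: pres_cat; [exact: pres_refl | exact: pres_sym].
Qed.

Lemma pres_invE u : pres_inv (pres_class u) = pres_class (word_inv u).
Proof. by apply/pres_classP; apply: word_inv_compat; apply: pres_reprP. Qed.

Let pres_mulA : associative pres_mul.
Proof.
move=> a b c; have [u <-] := pres_class_surj a.
have [v <-] := pres_class_surj b; have [w <-] := pres_class_surj c.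
by rewrite !pres_mulE catA.
Qed.

Let pres_mul1 : left_id (pres_class [::]) pres_mul.
Proof. by move=> a; have [u <-] := pres_class_surj a; rewrite pres_mulE. Qed.

Let pres_mulr1 : right_id (pres_class [::]) pres_mul.
Proof.
by move=> a; have [u <-] := pres_class_surj a; rewrite pres_mulE cats0.
Qed.

Let pres_mulV : left_inverse (pres_class [::]) pres_inv pres_mul.
Proof.
move=> a; have [u <-] := pres_class_surj a; rewrite pres_invE pres_mulE.
by apply/pres_classP; apply: word_mulVl.
Qed.

Let pres_mulrV : right_inverse (pres_class [::]) pres_inv pres_mul.
Proof.
move=> a; have [u <-] := pres_class_surj a; rewrite pres_invE pres_mulE.
by apply/pres_classP; apply: word_mulV.
Qed.

HB.instance Definition _ := isGroup.Build presented
  pres_mulA pres_mul1 pres_mulr1 pres_mulV pres_mulrV.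

End Presentation.

(* x o y = u o v whenever r (x, y) = (u, v) *)
Inductive structure_rel (X : Type) (r : X * X -> X * X) :
    word X -> word X -> Prop :=
| StructureRel x y u v : r (x, y) = (u, v) ->
    structure_rel r [:: (true, x); (true, y)] [:: (true, u); (true, v)].

Definition structure_group (X : choiceType) (r : X * X -> X * X) : groupType :=
  presented (structure_rel r).

Definition unique_product (G : groupType) : Prop :=
  forall A B : {fset G}, A != fset0 -> B != fset0 ->
    exists x : G, exists! p : G * G,
      [/\ p.1 \in A, p.2 \in B & x = p.1 * p.2].

(* Main.v *)
Require Import Defs.
From mathcomp Require Import all_boot.
From mathcomp Require Import order fingroup perm ssralg ssrint boolp finmap.

(** Write [psi x] for the inverse of [sigma x]; the solution is then encoded by
the law [psi (psi x y) (psi x z) = psi (psi y x) (psi y z)].  The theorem holds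
because, up to size 7, everything that is not a multipermutation solution is
caused by one of two solutions with four elements, the squares below, and the
structure group of a square contains the group of Promislow.

A solution [X] that is not multipermutation leads, after some retractions, to a
solution with at least two elements in which [sigma] is injective.  If its size
is at most 7, such a solution has a square as subsolution
([faithful_square]); this is a finite fact and is established by an exhaustive
search through partial multiplication tables, whose soundness is
[search_sound].  A square [W] in [Ret X] comes from a square in [X]
([ret_square]): any point of [W] is sent to any other one by some [sigma x]
with [x] in [W], so that the four fibres of [X -> Ret X] over [W] have the same
cardinality, which is 1 because [X] has fewer than 8 elements.

It remains to see that a square inside [X] destroys unique products in the
structure group [G].  Sending a multiset [x1 + ... + xk] to the class of the
positive word obtained by letting each letter act on the later ones is
injective: the class does not depend on the order of the [xi]
([positive_class_perm]), and the action of [G] by affine maps on the functions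
from [X] to the integers recovers the multiset from the class
([count_positive_class]).  Hence equalities between positive elements supported
on the square are equalities between vectors with four natural coordinates.  In
these coordinates one writes down a translate of the 14-element set found by
Promislow, in which every product occurs at least twice
([promislow_repeated]). *)

Set Implicit Arguments.
Unset Strict Implicit.
Unset Printing Implicit Defensive.

Import Order.Theory.

(** * The two squares *)

(** Row [i] lists the values of [psi i].  These are, up to isomorphism, the two
solutions with at most four elements that are not multipermutation. *)
Definition square_tables : seq (seq (seq nat)) :=
  [:: [:: [:: 1; 2; 3; 0]; [:: 3; 0; 1; 2]; [:: 0; 3; 2; 1]; [:: 2; 1; 0; 3]];
      [:: [:: 2; 1; 0; 3]; [:: 0; 3; 2; 1]; [:: 3; 0; 1; 2]; [:: 1; 2; 3; 0]]].

Definition entry (T : seq (seq nat)) i j := nth 0 (nth [::] T i) j.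

(** With [s = sigma r], the equation says that [psi (w i)], the inverse of
[s (w i)], acts on the four points as row [i] of the table. *)
Definition contains_square (X : Type) (s : X -> X -> X) : Prop :=
  exists (T : seq (seq nat)) (w : nat -> X),
    [/\ T \in square_tables, {in gtn 4 &, injective w}
      & forall i j, i < 4 -> j < 4 -> s (w i) (w (entry T i j)) = w j].

(** Every column is a permutation as well, which makes the fibres of a
retraction over a square equipotent. *)
Lemma square_columns T i j : T \in square_tables -> i < 4 -> j < 4 ->
  entry T i j < 4 /\ exists2 l, l < 4 & entry T l j = i.
Proof.
move=> TT i4 j4.
have : all (fun T => all (fun i => all (fun j =>
    (entry T i j < 4) && has (fun l => entry T l j == i) (iota 0 4))
  (iota 0 4)) (iota 0 4)) square_tables by [].
have iota4 l : l < 4 -> l \in iota 0 4 by rewrite mem_iota.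
move=> /allP/(_ T TT)/allP/(_ i (iota4 i i4))/allP/(_ j (iota4 j j4)).
case/andP=> e4 /hasP[l]; rewrite mem_iota => /= l4 /eqP e.
by split=> //; exists l.
Qed.

(** * Search through partial tables *)

Section Search.
Variable n : nat.

Definition table := seq (seq (option nat)).

Definition get (P : table) x y : option nat := nth None (nth [::] P x) y.

Fixpoint update (A : Type) (f : A -> A) (s : seq A) (i : nat) : seq A :=
  match s, i with
  | [::], _ => [::]
  | a :: s', 0 => f a :: s'
  | a :: s', i'.+1 => a :: update f s' i'
  end.

Definition put (P : table) x y v : table :=
  update (fun r => update (fun=> Some v) r y) P x.

Fixpoint index_of (v i : nat) (r : seq (option nat)) : option nat :=
  match r with
  | [::] => None
  | Some w :: r' => if eqn v w then Some i else index_of v i.+1 r'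
  | None :: r' => index_of v i.+1 r'
  end.

Definition free (P : table) x v : bool :=
  if index_of v 0 (nth [::] P x) is Some _ then false else true.

Definition on_diagonal (P : table) v : bool :=
  has (fun z => if get P z z is Some w then eqn v w else false) (iota 0 n).

(** The boolean of [Filled] records whether a cell has been filled. *)
Inductive outcome := Clash | Filled of table & bool.

Definition assign (P : table) (new : bool) x y v : outcome :=
  match get P x y with
  | Some w => if eqn v w then Filled P new else Clash
  | None => if free P x v then Filled (put P x y v) true else Clash
  end.

(** One instance of the law, where [u] and [v] are the cells [(x, y)] and
[(y, x)], and [ox], [oy] the cells [(x, z)] and [(y, z)]: the entries [(u, ox)]
and [(v, oy)] have to coincide.  If only one of [ox], [oy] is known, the other
may still be found by looking up the common value in its row. *)
Definition law_step (P : table) (new : bool) x y z u v ox oy : outcome :=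
  match ox, oy with
  | Some b, Some d =>
    match get P u b, get P v d with
    | Some p, _ => assign P new v d p
    | None, Some q => assign P new u b q
    | None, None => Filled P new
    end
  | Some b, None =>
    if get P u b is Some p then
      if index_of p 0 (nth [::] P v) is Some d then assign P new y z d
      else Filled P new
    else Filled P new
  | None, Some d =>
    if get P v d is Some q then
      if index_of q 0 (nth [::] P u) is Some b then assign P new x z b
      else Filled P new
    else Filled P new
  | None, None => Filled P new
  end.

(** The rows [rx] and [ry] may become outdated while [P] is being filled; they
then know less than [P], which is harmless. *)
Fixpoint law_row (P : table) (new : bool) x y z u v rx ry : outcome :=
  match rx, ry with
  | ox :: rx', oy :: ry' =>
    match law_step P new x y z u v ox oy with
    | Clash => Clash
    | Filled P' new' => law_row P' new' x y z.+1 u v rx' ry'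
    end
  | _, _ => Filled P new
  end.

Fixpoint law_pass (P : table) (new : bool) (l : seq (nat * nat)) : outcome :=
  match l with
  | [::] => Filled P new
  | (x, y) :: l' =>
    match get P x y, get P y x with
    | Some u, Some v =>
      match law_row P new x y 0 u v (nth [::] P x) (nth [::] P y) with
      | Clash => Clash
      | Filled P' new' => law_pass P' new' l'
      end
    | _, _ => law_pass P new l'
    end
  end.

(** Each pass but the last one fills a cell, so that [n * n] passes reach the
fixed point. *)
Fixpoint propagate prs fuel (P : table) : option table :=
  match fuel with
  | 0 => Some P
  | fuel'.+1 =>
    match law_pass P false prs with
    | Clash => None
    | Filled P' new => if new then propagate prs fuel' P' else Some P'
    end
  end.

(** False on rows that are not completely known. *)
Fixpoint same_row (r r' : seq (option nat)) : bool :=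
  match r, r' with
  | [::], [::] => true
  | Some v :: s, Some v' :: s' => if eqn v v' then same_row s s' else false
  | _, _ => false
  end.

Fixpoint twins (P : table) : bool :=
  if P is r :: P' then if has (same_row r) P' then true else twins P'
  else false.

(** A solution may be relabelled so that the list of its entries is
lexicographically smallest.  A relabelling is kept together with the cells on
which the comparison of the table with its conjugate is still pending; on the
earlier cells the two agree. *)
Record relabelling := Relabelling
  { image : seq nat; preimage : seq nat; todo : seq (nat * nat) }.

Fixpoint lessn (m p : nat) : bool :=
  match m, p with
  | _, 0 => false
  | 0, _.+1 => true
  | m'.+1, p'.+1 => lessn m' p'
  end.

Inductive comparison_result := Undecided of seq (nat * nat) | Larger | Smaller.

(** The position of the conjugate with respect to the table; a conjugate that
agrees on all cells counts as [Larger], since it cannot cut the branch. *)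
Fixpoint compare (P : table) (g h : seq nat) cs : comparison_result :=
  match cs with
  | [::] => Larger
  | (x, y) :: cs' =>
    match get P x y, get P (nth 0 h x) (nth 0 h y) with
    | Some v, Some w =>
      let w' := nth 0 g w in
      if eqn v w' then compare P g h cs'
      else if lessn v w' then Larger else Smaller
    | _, _ => Undecided cs
    end
  end.

Fixpoint prune (P : table) (hs : seq relabelling) : option (seq relabelling) :=
  match hs with
  | [::] => Some [::]
  | Relabelling g h cs :: hs' =>
    match compare P g h cs with
    | Smaller => None
    | Larger => prune P hs'
    | Undecided cs' =>
      if prune P hs' is Some l then Some (Relabelling g h cs' :: l) else None
    end
  end.

Definition square_at (P : table) T ws : bool :=
  [&& uniq ws, all (fun w => w < n) ws &
  all (fun i => all (fun j =>
      get P (nth 0 ws i) (nth 0 ws j) == Some (nth 0 ws (entry T i j)))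
    (iota 0 4)) (iota 0 4)].

(** Either square is generated by its point 0; the other points are recovered
from the table as the products that equal them in the square. *)
Definition has_square_table (P : table) : bool :=
  let op x y := odflt n (get P x y) in
  has (fun a =>
    let b := op a a in
    let c := op a b in
    square_at P (nth [::] square_tables 0) [:: a; b; c; op a c] ||
    square_at P (nth [::] square_tables 1) [:: a; op b b; b; op b a])
  (iota 0 n).

(** Comparing with all relabellings pays off only near the root of the tree,
hence the bound [depth] on the number of choices after which they are
dropped. *)
Fixpoint search depth prs (cs : seq (nat * nat)) hs (P : table) : bool :=
  match cs with
  | [::] => has_square_table P
  | (x, y) :: cs' =>
    if get P x y is Some _ then search depth prs cs' hs P
    else all (fun v =>
      if free P x v && ~~ (eqn x y && on_diagonal P v) then
        match propagate prs (n * n) (put P x y v) with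
        | None => true
        | Some P' =>
          if twins P' then true
          else if prune P' hs is Some hs' then
            search depth.-1 prs cs' (if depth is 0 then [::] else hs') P'
          else true
        end
      else true) (iota 0 n)
  end.

Fixpoint inserts (x : nat) s :=
  (x :: s) :: (if s is y :: s' then map (cons y) (inserts x s') else [::]).

Fixpoint arrangements s :=
  if s is x :: s' then flatten (map (inserts x) (arrangements s'))
  else [:: [::]].

(** Diagonal entries come first, so that minimality leaves one diagonal for
each cycle type; then a 3 by 3 corner, which triggers many instances of the
law. *)
Definition cells : seq (nat * nat) :=
  let off := [seq (x, y) | x <- iota 0 n, y <- rem x (iota 0 n)] in
  [seq (x, x) | x <- iota 0 n] ++
  [seq c <- off | maxn c.1 c.2 < 3] ++ [seq c <- off | 2 < maxn c.1 c.2].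

Definition is_perm_seq (g : seq nat) :=
  [&& size g == n, uniq g & all (fun v => v < n) g].

Definition relabellings :=
  [seq Relabelling g [seq index x g | x <- iota 0 n] cells
      | g <- [seq g <- arrangements (iota 0 n) | is_perm_seq g]].

Definition every_table_has_square : bool :=
  search 13 [seq (x, y) | x <- iota 0 n, y <- iota 0 x] cells relabellings
    (nseq n (nseq n None)).

(** * Soundness of the search *)

Section Soundness.
Variable m : nat -> nat -> nat.
Hypothesis m_lt : forall x y, x < n -> y < n -> m x y < n.
Hypothesis m_inj : forall x y y', x < n -> y < n -> y' < n ->
  m x y = m x y' -> y = y'.
Hypothesis m_law : forall x y z, x < n -> y < n -> z < n ->
  m (m x y) (m x z) = m (m y x) (m y z).
Hypothesis m_diag : forall x y, x < n -> y < n -> m x x = m y y -> x = y.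
Hypothesis m_faithful : forall x y, x < n -> y < n ->
  (forall z, z < n -> m x z = m y z) -> x = y.

Definition agrees (P : table) : Prop :=
  [/\ size P = n, forall x, x < n -> size (nth [::] P x) = n
    & forall x y v, get P x y = Some v -> m x y = v].

Lemma get_lt P x y v : agrees P -> get P x y = Some v -> x < n /\ y < n.
Proof.
case=> sP sr _; rewrite /get; case: (ltnP x n) => [xn | nx].
  by case: (ltnP y n) => // ny; rewrite nth_default ?sr.
by rewrite (nth_default [::]) ?sP // nth_nil.
Qed.

Lemma size_update (A : Type) (f : A -> A) s i : size (update f s i) = size s.
Proof. by elim: s i => [|a s IHs] [|i] //=; rewrite IHs. Qed.

Lemma nth_update (A : Type) (f : A -> A) d s i j :
  nth d (update f s i) j =
  if (j == i) && (i < size s) then f (nth d s j) else nth d s j.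
Proof.
by elim: s i j => [|a s IHs] [|i] [|j] //=; rewrite andbF.
Qed.

Lemma agrees_put P x y : x < n -> agrees P -> agrees (put P x y (m x y)).
Proof.
move=> xn [sP sr gP]; split.
- by rewrite size_update.
- move=> z zn; rewrite nth_update; case: ifP => _; rewrite ?size_update; exact: sr.
move=> z t v; rewrite /get nth_update; case: ifP => [/andP[/eqP-> _] | _].
  rewrite nth_update; case: ifP => [/andP[/eqP-> _] [<-] // | _].
  exact: gP.
exact: gP.
Qed.

Lemma index_ofP v i r d : index_of v i r = Some d ->
  exists2 e, d = i + e & nth None r e = Some v.
Proof.
elim: r i => [|[w|] r IHr] i //=.
  case: eqnP => [-> [<-] | _ /IHr[e -> re]]; first by exists 0; rewrite ?addn0.
  by exists e.+1; rewrite ?addSnnS.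
by move=> /IHr[e -> re]; exists e.+1; rewrite ?addSnnS.
Qed.

Lemma free_cell P x y : agrees P -> x < n -> y < n -> get P x y = None ->
  free P x (m x y).
Proof.
move=> aP xn yn gN; rewrite /free; case E: (index_of _ _ _) => [d|] //.
have [e _ re] := index_ofP E; have [_ en] := get_lt aP re.
have [_ _ /(_ _ _ _ re) me] := aP.
by move: re; rewrite (m_inj xn en yn me) -[nth _ _ _]/(get P x y) gN.
Qed.

Definition sound (o : outcome) : Prop :=
  if o is Filled P _ then agrees P else False.

Lemma assign_sound P new x y : agrees P -> x < n -> y < n ->
  sound (assign P new x y (m x y)).
Proof.
move=> aP xn yn; rewrite /assign; case E: (get P x y) => [w|].
  by have [_ _ /(_ _ _ _ E)->] := aP; case: eqnP.
by rewrite free_cell //=; apply: agrees_put.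
Qed.

Lemma index_of_row P x y v : agrees P -> x < n -> y < n ->
  index_of (m x y) 0 (nth [::] P x) = Some v -> v = y.
Proof.
move=> aP xn yn /index_ofP[e -> re]; have [_ en] := get_lt aP re.
by apply: (m_inj xn) => //; have [_ _] := aP; apply.
Qed.

Lemma law_step_sound P new x y z ox oy : agrees P ->
  x < n -> y < n -> z < n ->
  (forall b, ox = Some b -> m x z = b) -> (forall d, oy = Some d -> m y z = d) ->
  sound (law_step P new x y z (m x y) (m y x) ox oy).
Proof.
move=> aP xn yn zn hx hy; have [_ _ gP] := aP.
have xyn := m_lt xn yn; have yxn := m_lt yn xn.
have xzn := m_lt xn zn; have yzn := m_lt yn zn.
have law := m_law xn yn zn.
case: ox oy hx hy => [b|] [d|] hx hy //=.
- rewrite -(hx b) // -(hy d) //.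
  case Ep: (get P _ _) => [p|].
    by rewrite -(gP _ _ _ Ep) law; apply: assign_sound.
  case Eq: (get P _ _) => [q|] //.
  by rewrite -(gP _ _ _ Eq) -law; apply: assign_sound.
- rewrite -(hx b) //; case Ep: (get P _ _) => [p|] //.
  rewrite -(gP _ _ _ Ep) law.
  case E: (index_of _ _ _) => [e|] //.
  by rewrite (index_of_row aP yxn yzn E); apply: assign_sound.
- rewrite -(hy d) //; case Eq: (get P _ _) => [q|] //.
  rewrite -(gP _ _ _ Eq) -law.
  case E: (index_of _ _ _) => [e|] //.
  by rewrite (index_of_row aP xyn xzn E); apply: assign_sound.
Qed.

Lemma law_row_sound P new x y z rx ry : agrees P -> x < n -> y < n ->
  z + size rx <= n ->
  (forall i b, nth None rx i = Some b -> m x (z + i) = b) ->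
  (forall i d, nth None ry i = Some d -> m y (z + i) = d) ->
  sound (law_row P new x y z (m x y) (m y x) rx ry).
Proof.
elim: rx ry P new z => [|ox rx IHr] [|oy ry] P new z aP xn yn //= zn hx hy.
have zn' : z < n by apply: leq_trans zn; rewrite addnS ltnS leq_addr.
have hx0 b : ox = Some b -> m x z = b by move=> e; rewrite -[z]addn0; apply: (hx 0).
have hy0 d : oy = Some d -> m y z = d by move=> e; rewrite -[z]addn0; apply: (hy 0).
have := law_step_sound new aP xn yn zn' hx0 hy0.
case: law_step => //= P' new' aP'; apply: IHr => // [|i b e|i d e].
- by rewrite addSnnS.
- by rewrite addSnnS; apply: (hx i.+1).
- by rewrite addSnnS; apply: (hy i.+1).
Qed.

Lemma law_pass_sound P new prs : agrees P -> sound (law_pass P new prs).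
Proof.
elim: prs P new => [|[x y] prs IHp] P new aP //=.
case Eu: (get P x y) => [u|]; last exact: IHp.
case Ev: (get P y x) => [v|]; last exact: IHp.
have [xn yn] := get_lt aP Eu; have [_ sr gP] := aP.
have := @law_row_sound P new x y 0 (nth [::] P x) (nth [::] P y) aP xn yn.
rewrite sr // (gP _ _ _ Eu) (gP _ _ _ Ev) => h.
have {h} := h (leqnn _) (fun i b => gP x i b) (fun i b => gP y i b).
by case: law_row => //= P' new' aP'; apply: IHp.
Qed.

Lemma propagate_sound prs fuel P : agrees P ->
  if propagate prs fuel P is Some P' then agrees P' else False.
Proof.
elim: fuel P => //= fuel IHf P aP; have := law_pass_sound false prs aP.
by case: law_pass => //= P' [] // aP'; apply: IHf.
Qed.

Lemma same_rowP r r' i : same_row r r' -> i < size r ->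
  exists v, nth None r i = Some v /\ nth None r' i = Some v.
Proof.
elim: r r' i => [|[v|] r IHr] [|[v'|] r'] [|i] //=; case: eqnP => // vv' sr.
  by exists v; rewrite -vv'.
exact: IHr.
Qed.

Lemma twinsP P : twins P -> exists i j,
  [/\ i < j, j < size P & same_row (nth [::] P i) (nth [::] P j)].
Proof.
elim: P => //= r P IHP; case: ifP => [/(has_nthP [::])[j jP rj] _ | _ /IHP].
  by exists 0, j.+1.
by move=> [i [j [ij jP rij]]]; exists i.+1, j.+1.
Qed.

Lemma no_twins P : agrees P -> twins P = false.
Proof.
move=> [sP sr gP]; apply/negP=> /twinsP[i [j [ij jn rij]]].
rewrite sP in jn; have i_n := ltn_trans ij jn.
suff ij' : i = j by rewrite ij' ltnn in ij.
apply: m_faithful => // z zn.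
have [|v [iv jv]] := same_rowP rij (i := z); first by rewrite sr.
by rewrite (gP i z v iv) (gP j z v jv).
Qed.

Lemma on_diagonal_fresh P x : agrees P -> x < n -> get P x x = None ->
  on_diagonal P (m x x) = false.
Proof.
move=> aP xn gx; apply/negP=> /hasP[z]; rewrite mem_iota => /= zn.
case E: (get P z z) => [w|] //; case: eqnP => // xw _.
have [_ _ /(_ _ _ _ E)] := aP; rewrite -xw => /(m_diag zn xn) zx.
by rewrite -zx E in gx.
Qed.

Definition conjugate (g h : seq nat) x y :=
  nth 0 g (m (nth 0 h x) (nth 0 h y)).

Fixpoint lex_le (cs : seq (nat * nat)) (m1 m2 : nat -> nat -> nat) : bool :=
  if cs is (x, y) :: cs' then
    (m1 x y < m2 x y) || (m1 x y == m2 x y) && lex_le cs' m1 m2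
  else true.

Definition minimal_for (s : relabelling) : bool :=
  lex_le (todo s) m (conjugate (image s) (preimage s)).

Lemma lessnE p q : lessn p q = (p < q).
Proof. by elim: p q => [|p IHp] [|q] //=; rewrite IHp. Qed.

Lemma compare_sound P g h cs : agrees P -> lex_le cs m (conjugate g h) ->
  match compare P g h cs with
  | Undecided cs' => lex_le cs' m (conjugate g h)
  | Larger => true
  | Smaller => false
  end.
Proof.
move=> [_ _ gP]; elim: cs => //= -[x y] cs IHc le.
case Ev: (get P x y) => [v|] //; case Ew: (get P _ _) => [w|] //.
move: le; rewrite /conjugate (gP _ _ _ Ev) (gP _ _ _ Ew).
case: eqnP => [<-|ne]; first by rewrite ltnn eqxx => /IHc.
by rewrite lessnE; case: ltnP => //= _ /andP[/eqP].
Qed.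

Lemma prune_sound P hs : agrees P -> all minimal_for hs ->
  if prune P hs is Some hs' then all minimal_for hs' else false.
Proof.
move=> aP; elim: hs => //= -[g h cs] hs IHh /andP[le /IHh].
have := compare_sound aP le; case: compare => //= cs' le'.
by case: prune => //= hs' hs'P; apply/andP.
Qed.

Definition has_square_op : Prop :=
  exists ws T, [/\ size ws = 4, uniq ws, all (fun w => w < n) ws,
    T \in square_tables & forall i j, i < 4 -> j < 4 ->
      m (nth 0 ws i) (nth 0 ws j) = nth 0 ws (entry T i j)].

Lemma square_atP P T ws : agrees P -> T \in square_tables -> size ws = 4 ->
  square_at P T ws -> has_square_op.
Proof.
move=> [_ _ gP] TT s4 /and3P[uws wn /allP h]; exists ws, T; split=> // i j i4 j4.
have iota4 k : k < 4 -> k \in iota 0 4 by rewrite mem_iota.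
by have /allP/(_ j (iota4 j j4))/eqP := h i (iota4 i i4); apply: gP.
Qed.

Lemma has_square_tableP P : agrees P -> has_square_table P -> has_square_op.
Proof.
by move=> aP /hasP[a _ /orP[]]; apply: square_atP.
Qed.

(** The entry [m x y] is one of the values tried at the cell [(x, y)], and the
branch of that value is never cut: propagation only fills in entries of [m],
equal rows contradict faithfulness, and a smaller conjugate contradicts
minimality.  So some leaf agrees with [m], and its square is one of [m]. *)
Lemma search_sound depth prs cs hs P : search depth prs cs hs P ->
  all (fun c => (c.1 < n) && (c.2 < n)) cs ->
  agrees P -> all minimal_for hs -> has_square_op.
Proof.
elim: cs depth hs P => [|[x y] cs IHc] depth hs P /=.
  by move=> sq _ aP _; apply: has_square_tableP sq.
case E: (get P x y) => [v|] sr /andP[/andP[/= xn yn] cn] aP hsP.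
  exact: IHc sr cn aP hsP.
have {sr}/allP/(_ (m x y)) := sr; rewrite mem_iota => /(_ (m_lt xn yn)).
rewrite free_cell //.
have -> : eqn x y && on_diagonal P (m x y) = false.
  case: eqnP => //= xy; rewrite -xy; apply: on_diagonal_fresh => //.
  by rewrite {2}xy.
have := propagate_sound prs (n * n) (agrees_put y xn aP).
case: propagate => // P' aP'; rewrite no_twins //=.
have := prune_sound aP' hsP; case: prune => // hs' hsP' sr.
by apply: IHc sr cn aP' _; case: (depth).
Qed.

Lemma agrees_empty : agrees (nseq n (nseq n None)).
Proof.
split; first by rewrite size_nseq.
  by move=> x xn; rewrite nth_nseq xn size_nseq.
move=> x y v; rewrite /get nth_nseq.
by case: ifP; rewrite ?nth_nil // nth_nseq; case: ifP.
Qed.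

Lemma cells_lt : all (fun c => (c.1 < n) && (c.2 < n)) cells.
Proof.
apply/allP=> c; rewrite !mem_cat !mem_filter.
have offP : c \in [seq (x, y) | x <- iota 0 n, y <- rem x (iota 0 n)] ->
    (c.1 < n) && (c.2 < n).
  case/allpairsPdep=> x [y [xn /mem_rem yn ->]] /=.
  by move: xn yn; rewrite !mem_iota !add0n => /= -> ->.
case/or3P=> [/mapP[x xn ->] | /andP[_] | /andP[_]] //.
by move: xn; rewrite mem_iota add0n => /= ->.
Qed.

Lemma every_table_has_square_sound : every_table_has_square ->
  (forall g, is_perm_seq g ->
     lex_le cells m (conjugate g [seq index x g | x <- iota 0 n])) ->
  has_square_op.
Proof.
move=> sr min; apply: (search_sound sr cells_lt agrees_empty).
by rewrite all_map; apply/allP=> g; rewrite mem_filter => /andP[pg _]; apply: min.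
Qed.

End Soundness.
End Search.

(** * Removing the choice of labels *)

Section FaithfulSquare.
Local Open Scope group_scope.
Variables (k : nat) (psi : 'I_k.+1 -> {perm 'I_k.+1}).
Hypothesis psi_law : forall x y z,
  psi (psi x y) (psi x z) = psi (psi y x) (psi y z).
Hypothesis psi_diag : injective (fun x => psi x x).
Hypothesis psi_inj : injective psi.

Definition relabelled (p : {perm 'I_k.+1}) (x y : nat) : nat :=
  p (psi (p^-1 (inord x)) (p^-1 (inord y))).

Definition values (p : {perm 'I_k.+1}) : seqlexi nat :=
  [seq relabelled p c.1 c.2 | c <- cells k.+1].

Lemma lex_le_values cs (m1 m2 : nat -> nat -> nat) :
  (([seq m1 c.1 c.2 | c <- cs] : seqlexi nat) <= [seq m2 c.1 c.2 | c <- cs])%O ->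
  lex_le cs m1 m2.
Proof.
elim: cs => //= -[x y] cs IHc; rewrite Order.SeqLexiOrder.Exports.lexi_cons /=.
case/andP=> le12 /implyP h; rewrite ltn_neqAle -!leEnat.
case: eqP => e /=; first by apply: IHc; apply: h; rewrite e.
by rewrite orbF.
Qed.

Lemma lex_le_eq cs m1 m2 m2' :
  {in cs, forall c, m2 c.1 c.2 = m2' c.1 c.2} ->
  lex_le cs m1 m2 = lex_le cs m1 m2'.
Proof.
elim: cs => //= -[x y] cs IHc e; rewrite -(e (x, y)) ?mem_head // IHc //.
by move=> c cc; apply: e; rewrite in_cons cc orbT.
Qed.

Lemma is_perm_seqP g : is_perm_seq k.+1 g ->
  exists p : {perm 'I_k.+1}, forall x : 'I_k.+1,
    p x = nth 0 g x :> nat /\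
    p^-1 x = nth 0 [seq index x g | x <- iota 0 k.+1] x :> nat.
Proof.
case/and3P=> /eqP sg ug /allP lg.
have gl (x : 'I_k.+1) : nth 0 g x < k.+1 by apply/lg/mem_nth; rewrite sg.
pose f (x : 'I_k.+1) : 'I_k.+1 := Ordinal (gl x).
have fI : injective f.
  by move=> x y [] /eqP; rewrite nth_uniq ?sg // => /eqP/val_inj.
exists (perm fI) => x; rewrite permE; split=> //.
rewrite (nth_map 0) ?size_iota // nth_iota // add0n.
have -> : (x : nat) = nth 0 g ((perm fI)^-1 x).
  by rewrite -[in LHS](permKV (perm fI) x) permE.
by rewrite index_uniq ?sg // permKV.
Qed.

(** The search applies to the relabelling of [psi] with the smallest list of
values, and the square found there is carried back. *)
Lemma faithful_square : every_table_has_square k.+1 ->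
  contains_square (fun x => (psi x)^-1).
Proof.
move=> search.
pose p := [arg min_(q < 1%g) values q]%O; pose m := relabelled p.
have minP q : (values p <= values q)%O.
  by rewrite /p; case: Order.TotalTheory.arg_minP => // r _; apply.
have mE (x y : 'I_k.+1) : m x y = p (psi (p^-1 x) (p^-1 y)).
  by rewrite /m /relabelled !inord_val.
have m_lt x y : x < k.+1 -> y < k.+1 -> m x y < k.+1 by move=> *; apply: ltn_ord.
have : has_square_op k.+1 m.
  apply: every_table_has_square_sound => //.
  - move=> x y y' xn yn yn'.
    rewrite (mE (Ordinal xn) (Ordinal yn)) (mE (Ordinal xn) (Ordinal yn')).
    by move=> /val_inj/perm_inj/perm_inj/perm_inj[].
  - move=> x y z xn yn zn.
    rewrite (mE (Ordinal xn) (Ordinal yn)) (mE (Ordinal xn) (Ordinal zn)).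
    rewrite (mE (Ordinal yn) (Ordinal xn)) (mE (Ordinal yn) (Ordinal zn)).
    by rewrite !mE !permK psi_law.
  - move=> x y xn yn.
    rewrite (mE (Ordinal xn) (Ordinal xn)) (mE (Ordinal yn) (Ordinal yn)).
    by move=> /val_inj/perm_inj/psi_diag/perm_inj[].
  - move=> x y xn yn e.
    suff: Ordinal xn = Ordinal yn by case.
    apply/(@perm_inj _ p^-1)/psi_inj/permP => z.
    have := e (p z) (ltn_ord _).
    rewrite (mE (Ordinal xn)) (mE (Ordinal yn)) permK.
    by move=> /val_inj/perm_inj.
  (* The conjugate by [q] of the table relabelled by [p] is the table relabelled
     by [p * q]. *)
  move=> g /is_perm_seqP[q qE].
  rewrite (@lex_le_eq _ _ _ (relabelled (p * q))); first exact/lex_le_values/minP.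
  move=> [x y] /(allP (cells_lt _))/andP[/= xn yn].
  have [qx qx'] := qE (Ordinal xn); have [qy qy'] := qE (Ordinal yn).
  have ordE z (zn : z < k.+1) : inord z = Ordinal zn.
    by apply/val_inj; rewrite /= inordK.
  rewrite /conjugate -qx' -qy' mE -(qE _).1 /relabelled !ordE.
  by rewrite invMg !permM.
case=> ws [T [s4 uws wn TT h]].
exists T, (fun i => p^-1 (inord (nth 0 ws i))); split=> //.
  move=> i j i4 j4 /perm_inj/(congr1 (@nat_of_ord _)).
  have wl l : l < 4 -> nth 0 ws l < k.+1.
    by move=> l4; apply/(allP wn)/mem_nth; rewrite s4.
  by rewrite !inordK ?wl // => /eqP; rewrite nth_uniq ?s4 // => /eqP.
move=> i j i4 j4; rewrite -(h i j i4 j4) /m /relabelled inord_val permK.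
by rewrite permK.
Qed.
End FaithfulSquare.

(** * Lifting squares through retractions *)

(** Involutivity gives [tau (psi x y) x = psi y x], so that the first component
of the Yang-Baxter equation becomes the law of [psi].  In particular
[tau (psi x x) x = psi x x], and [psi x x] determines [x] because [tau] is
nondegenerate. *)
Lemma solution_psi (X : Type) (r : X * X -> X * X) :
  is_involutive_solution r ->
  exists psi : X -> X -> X,
    [/\ forall x, cancel (psi x) (sigma r x), forall x, cancel (sigma r x) (psi x),
        forall x y z, psi (psi x y) (psi x z) = psi (psi y x) (psi y z)
      & injective (fun x => psi x x)].
Proof.
case=> -[_ _ ybe [s_bij t_bij]] rK.
have /boolp.choice[psi psiP] x :
    exists p, cancel p (sigma r x) /\ cancel (sigma r x) p.
  by have [g sg gs] := s_bij x; exists g.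
have sK x y : sigma r (sigma r x y) (tau r y x) = x.
  by rewrite {1}/sigma -[(_, _)]surjective_pairing rK.
have ss x y z : sigma r (sigma r x y) (sigma r (tau r y x) z) = sigma r x (sigma r y z).
  exact: (congr1 (fun p => p.1.1) (ybe (x, y, z))).
have tE x y : tau r (psi x y) x = psi y x.
  by rewrite -[in RHS](sK x (psi x y)) (psiP x).1 (psiP y).2.
exists psi; split=> [x|x|x y z|x y /= d]; try by case: (psiP x).
  apply: (can_inj (psiP (psi x y)).2).
  apply: (can_inj (psiP x).2); rewrite (psiP _).1.
  rewrite -(ss x (psi x y)) tE (psiP x).1 (psiP x).1.
  by rewrite (psiP (psi y x)).1 (psiP y).1.
apply: (bij_inj (t_bij (psi x x))).
by rewrite {2}d !tE.
Qed.

Lemma not_injective_witness (A B : Type) (f : A -> B) :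
  ~ injective f -> exists x y, f x = f y /\ x <> y.
Proof.
move=> nf; apply: boolp.contrapT => h; apply: nf => x y e.
by apply: boolp.contrapT => ne; apply: h; exists x, y.
Qed.

(** Used to list the classes of a retraction, and to see that there are fewer
classes than elements when two elements are identified. *)
Lemma surjection_enum (A : Type) k (f : 'I_k -> A) :
  (forall a, exists i, f i = a) ->
  exists k' (g : 'I_k' -> A), [/\ bijective g, k' <= k & injective f \/ k' < k].
Proof.
elim: k f => [|k IHk] f surj.
  by exists 0, f; split; [apply: inj_surj_bij => // -[] | | left=> -[]].
have [fI | nf] := boolp.EM (injective f).
  have f_bij := inj_surj_bij fI surj.
  by exists k.+1, f; split; [|exact: leqnn|left].
have [i [j [fij ij]]] := not_injective_witness nf.
have [a|k' [g [g_bij k'k _]]] := IHk (f \o lift i).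
  have [l <-] := surj a; case: (unliftP i l) => [l' -> | ->]; first by exists l'.
  case: (unliftP i j) => [j' ej | ej]; last by rewrite ej in ij.
  by exists j'; rewrite fij ej.
by exists k', g; split; [|exact: leqW|right].
Qed.

Section RetractionLift.
Variable S : qset.
Hypothesis solS : is_involutive_solution (@qmap S).
Notation s := (sigma (@qmap S)).
Notation pi := (@ret_class S).

Lemma sigma_Ret x y : sigma (@qmap (Ret S)) (pi x) (pi y) = pi (s x y).
Proof. exact: (congr1 fst (ret_mapE solS x y)). Qed.

(** If the fibre over one point of the square has two elements, then so has the
fibre over each of the four points, since some [sigma (v l)] maps the one into
the other; this makes 8 elements.  With singleton fibres, any choice [v] of
preimages is again a square. *)
Lemma ret_square k (f : 'I_k -> S) : bijective f -> k < 8 ->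
  contains_square (sigma (@qmap (Ret S))) -> contains_square s.
Proof.
case=> g fK gK k8 [T [w [TT wI wT]]].
have s_inj x : injective (s x) by case: solS => -[_ _ _ [/(_ x)/bij_inj]].
have /boolp.choice[v vE] i : exists x : S, pi x = w i.
  exact: ret_class_surj.
have step i j x : i < 4 -> j < 4 -> pi x = w (entry T i j) -> pi (s (v i) x) = w j.
  by move=> i4 j4 px; rewrite -sigma_Ret px vE wT.
have one j x : j < 4 -> pi x = w j -> x = v j.
  move=> j4 px; apply: boolp.contrapT => xv.
  have pair i : i < 4 -> exists y : bool -> S, injective y /\ forall b, pi (y b) = w i.
    move=> i4; have [_ [l l4 e]] := square_columns TT j4 i4.
    exists (fun b => s (v l) (if b then x else v j)); split.
      by move=> [] [] // /s_inj // e'; case: xv.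
    by case; apply: step => //; rewrite e.
  have {pair} /boolp.choice[y yP] (i : 'I_4) : exists y : bool -> S,
      injective y /\ forall b, pi (y b) = w i by apply: pair.
  have : #|{: 'I_4 * bool}| <= #|'I_k|.
    apply: (@leq_card _ _ (fun c => g (y c.1 c.2))) => -[i b] [i' b'] /= /(can_inj gK) e.
    have ei : i = i'.
      apply/val_inj/wI; rewrite ?inE ?ltn_ord //.
      by rewrite -((yP i).2 b) -((yP i').2 b') e.
    by rewrite -ei in e *; rewrite ((yP i).1 _ _ e).
  by rewrite card_prod card_bool !card_ord leqNgt k8.
exists T, v; split=> // [i j i4 j4 e|i j i4 j4].
  by apply: wI => //; rewrite -!vE e.
by apply: one => //; apply: step.
Qed.

End RetractionLift.

Lemma injective_square k (search : every_table_has_square k.+1) (S : Type)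
    (r : S * S -> S * S) (f : 'I_k.+1 -> S) :
  is_involutive_solution r -> bijective f -> injective (sigma r) ->
  contains_square (sigma r).
Proof.
move=> /solution_psi[psi [psiK sK law diag]] [g fK gK] s_inj.
have qI i : injective (fun j => g (psi (f i) (f j))).
  by move=> j j' /(can_inj gK)/(can_inj (psiK _))/(can_inj fK).
pose q i := perm (qI i).
have qE i j : f (q i j) = psi (f i) (f j) by rewrite permE gK.
have [i j l|i j /(congr1 f)|i j e||] := @faithful_square k q.
- by apply: (can_inj fK); rewrite !qE law.
- by rewrite /= !qE => /diag/(can_inj fK).
- apply: (can_inj fK); apply: s_inj; apply: boolp.funext => x.
  have e' y : psi (f i) y = psi (f j) y by rewrite -[y]gK -!qE e.
  by rewrite -{1}(sK (f j) x) -e' psiK.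
- exact: search.
move=> T [w [TT wI wT]]; exists T, (f \o w); split=> //.
  by move=> a b a4 b4 /(can_inj fK); apply: wI.
move=> a b a4 b4 /=; rewrite -(wT a b a4 b4).
by rewrite -{1}(permKV (q (w a)) (w (entry T a b))) qE psiK.
Qed.

Section Tower.
Hypothesis search : forall k, 0 < k < 7 -> every_table_has_square k.+1.

(** Induction on the size: either [sigma] is injective and the search applies,
or the retraction is smaller. *)
Lemma tower_square k (S : qset) (f : 'I_k -> S) :
  is_involutive_solution (@qmap S) -> bijective f -> k < 8 ->
  (forall n, ~ one_element (iter n Ret S)) ->
  contains_square (sigma (@qmap S)).
Proof.
elim/ltn_ind: k S f => k IHk S f solS f_bij k8 many.
have [s_inj | ns_inj] := boolp.EM (injective (sigma (@qmap S))).
  case: k f {IHk} f_bij k8 => [|[|k]] f f_bij k8.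
  - have [[[x] _ _ _] _] := solS; have [g _ _] := f_bij.
    by have := ltn_ord (g x); rewrite ltn0.
  - case: (many 0); exists (f ord0) => y; have [g _ gK] := f_bij.
    by rewrite -(gK y) (ord1 (g y)).
  - exact: (injective_square (@search k.+1 k8) solS f_bij s_inj).
have [x [y [sxy xy]]] := not_injective_witness ns_inj.
have [|k' [f' [f'_bij k'k fI]]] := @surjection_enum (Ret S) k (@ret_class S \o f).
  move=> a; have [z <-] := ret_class_surj a; have [g _ gK] := f_bij.
  by exists (g z); rewrite /= gK.
apply: (ret_square solS f_bij k8).
have k'_lt : k' < k.
  case: fI => // fI; case: xy; have [g _ gK] := f_bij.
  rewrite -(gK x) -(gK y); congr f; apply: fI; rewrite /= !gK.
  exact/ret_classP.
apply: (IHk k' k'_lt _ f') => //.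
- exact: Ret_involutive_solution.
- exact: ltn_trans k'_lt k8.
- by move=> n; rewrite -iterSr; apply: many.
Qed.

End Tower.

(** * Positive elements of the structure group *)

Section LiftWord.
Variables (X : Type) (psi : X -> X -> X).

(** The letter [x], read after a word whose inverse acts as [a], contributes the
letter [a x].  So [lift_word id] turns a sum [x1 + ... + xk] of generators,
taken in the additive group on which the structure group acts, into a word for
the corresponding group element, and [lift_map id] is the inverse of the
action of that element. *)
Fixpoint lift_word (a : X -> X) (s : seq X) : seq X :=
  if s is x :: s' then a x :: lift_word (psi (a x) \o a) s' else [::].

Fixpoint lift_map (a : X -> X) (s : seq X) : X -> X :=
  if s is x :: s' then lift_map (psi (a x) \o a) s' else a.

Lemma lift_word_cat a s t :
  lift_word a (s ++ t) = lift_word a s ++ lift_word (lift_map a s) t.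
Proof. by elim: s a => //= x s IHs a; rewrite IHs. Qed.

Lemma lift_word_map a b s : lift_word b (map a s) = lift_word (b \o a) s.
Proof. by elim: s b => //= x s IHs b; rewrite IHs. Qed.

End LiftWord.

Section StructureGroup.
Variables (X : choiceType) (r : X * X -> X * X) (psi : X -> X -> X).
Hypothesis solr : is_involutive_solution r.
Notation s_ := (sigma r).
Hypothesis psiK : forall x, cancel (psi x) (s_ x).
Hypothesis sK : forall x, cancel (s_ x) (psi x).
Hypothesis law : forall x y z,
  psi (psi x y) (psi x z) = psi (psi y x) (psi y z).

Definition positive (s : seq X) : word X := [seq (true, x) | x <- s].

(** The defining relations of the structure group, in terms of [psi]. *)
Lemma positive_swap x y :
  pres_eq (structure_rel r) (positive [:: x; psi x y]) (positive [:: y; psi y x]).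
Proof.
have [_ rK] := solr.
have r_psi : r (x, psi x y) = (y, tau r (psi x y) x).
  by rewrite [LHS]surjective_pairing; congr pair; apply: psiK.
have -> : psi y x = tau r (psi x y) x.
  by apply: (can_inj (sK y)); rewrite psiK /sigma -r_psi rK.
exact/pres_rel/StructureRel.
Qed.

Definition positive_class (s : seq X) : structure_group r :=
  pres_class (structure_rel r) (positive (lift_word psi id s)).

(** Exchanging two adjacent summands replaces the factor [p] followed by
[psi p q] by [q] followed by [psi q p], which is a defining relation; by the law
of [psi], the later letters do not change. *)
Lemma lift_word_perm a s t : perm_eq s t ->
  pres_eq (structure_rel r) (positive (lift_word psi a s))
    (positive (lift_word psi a t)).
Proof.
have cons_eq x u v : pres_eq (structure_rel r) (positive u) (positive v) ->
    pres_eq (structure_rel r) (positive (x :: u)) (positive (x :: v)).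
  move=> uv; apply: (@pres_cat _ _ [:: (true, x)] [:: (true, x)]) => //.
  exact: pres_refl.
have front b u x v : pres_eq (structure_rel r) (positive (lift_word psi b (u ++ x :: v)))
    (positive (lift_word psi b (x :: u ++ v))).
  elim: u b => [|y u IHu] b /=; first exact: pres_refl.
  apply: (pres_trans (cons_eq _ _ _ (IHu _))) => /=.
  have -> : psi (psi (b y) (b x)) \o (psi (b y) \o b) =
            psi (psi (b x) (b y)) \o (psi (b x) \o b).
    by apply: boolp.funext => z /=; apply: law.
  apply: (@pres_cat _ _ (positive [:: b y; psi (b y) (b x)])
    (positive [:: b x; psi (b x) (b y)])).
    exact: positive_swap.
  exact: pres_refl.
elim: s t a => [|x s IHs] t a.
  by rewrite perm_sym => /perm_nilP->; exact: pres_refl.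
move=> xst; have : x \in t by rewrite -(perm_mem xst) mem_head.
move=> /splitPr tE; case: tE xst => t1 t2 xst.
apply: (pres_trans _ (pres_sym (front _ _ _ _))).
apply/cons_eq/IHs.
rewrite -(perm_cons x) (perm_trans xst) //.
exact/permEl/(perm_catCA t1 [:: x] t2).
Qed.

Lemma positive_class_perm s t : perm_eq s t -> positive_class s = positive_class t.
Proof. by move=> st; apply/pres_classP/lift_word_perm. Qed.

(** The group law in additive coordinates: the second factor has to be twisted
by the action of the first one before the multisets are added. *)
Lemma positive_classM s t :
  (positive_class s * positive_class (map (lift_map psi id s) t))%g =
  positive_class (s ++ t).
Proof.
rewrite /positive_class -[(_ * _)%g]/(pres_mul _ _) pres_mulE.
by rewrite lift_word_cat lift_word_map /positive map_cat.
Qed.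

Import GRing.Theory.
Local Open Scope ring_scope.

(** A generator acts by its permutation of the coordinates followed by the
translation by the corresponding basis vector. *)
Definition affine (l : bool * X) (f : X -> int) (z : X) : int :=
  if l.1 then f (psi l.2 z) + (z == l.2)%:Z
  else f (s_ l.2 z) - (s_ l.2 z == l.2)%:Z.

Lemma affine_respects u v : pres_eq (structure_rel r) u v ->
  forall f, foldr affine f u = foldr affine f v.
Proof.
elim=> {u v} [u v [x y u' v' rxy] | b x | | u v _ IH | u v w _ IH1 _ IH2
  | u u' v v' _ IH1 _ IH2] f //.
- have yE : y = psi x u' by rewrite -[u']/(u', v').1 -rxy; apply/esym/sK.
  have vE : v' = psi u' x.
    have [_ rK] := solr; have : s_ u' v' = x by rewrite /sigma -rxy rK.
    by move=> <-; rewrite sK.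
  apply: boolp.funext => z; rewrite /affine /= yE vE law -!addrA; congr (_ + _).
  rewrite !(can_eq (psiK _)).
  by rewrite addrC.
- apply: boolp.funext => z; rewrite /affine /=; case: b => /=.
    by rewrite psiK subrK.
  by rewrite sK addrK.
- by rewrite IH1.
by rewrite !foldr_cat IH1 IH2.
Qed.

(** Applied to the zero function, the word of a multiset gives its
multiplicities. *)
Lemma affine_lift_word a s z : injective a ->
  foldr affine (fun=> 0) (positive (lift_word psi a s)) z =
  (count (fun x => a x == z) s)%:Z.
Proof.
elim: s a z => //= x s IHs a z a_inj; rewrite {1}/affine /= IHs; last first.
  by move=> y y' /= /(can_inj (psiK _))/a_inj.
rewrite -PoszD addnC (eq_sym z); congr (Posz (_ + _)).
by apply: eq_count => y /=; rewrite (can_eq (psiK _)).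
Qed.

Lemma count_positive_class s t z : positive_class s = positive_class t ->
  count_mem z s = count_mem z t.
Proof.
move=> /pres_classP/affine_respects/(_ (fun=> 0))/(congr1 (@^~ z)).
by rewrite !affine_lift_word // => -[].
Qed.

End StructureGroup.

(** * Products without uniqueness in a square *)

(** The product of [positive_classM] inside a square, where [index] inverts the
permutation [lift_map (entry T) id s] of the four points. *)
Definition times (T : seq (seq nat)) (s t : seq nat) : seq nat :=
  s ++ [seq index j [seq lift_map (entry T) id s i | i <- iota 0 4] | j <- t].

(** In additive coordinates, the elements of the structure group of a square are
vectors with four integer coordinates.  In either square, the elements
x = (-1,0,0,1) and y = (-1,1,0,0) satisfy the relations [x^-1 y^2 x = y^-2] and
[y^-1 x^2 y = x^-2] of the group of Promislow.  Their squares a = (-1,1,-1,1)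
and b = (-1,1,1,-1), and the square c = (-1,-1,1,1) of xy, act trivially, so
that multiplying by them on the left amounts to adding vectors.  The set is
x + {0, -a, b-a, b, -a-c, c}, y + {0, a, -b, c-b, c, a-b+c} and {c, -c}, in this
order.  All vectors are shifted by (2,2,2,2), which is a central element, to
make them nonnegative; this multiplies all products by the same element. *)
Definition promislow_set : seq (seq nat) :=
  [seq flatten [seq nseq (nth 0 v i) i | i <- iota 0 4]
     | v <- [:: [:: 1; 2; 2; 3]; [:: 2; 1; 3; 2]; [:: 1; 2; 4; 1];
                [:: 0; 3; 3; 2]; [:: 3; 2; 2; 1]; [:: 0; 1; 3; 4];
                [:: 1; 3; 2; 2]; [:: 0; 4; 1; 3]; [:: 2; 2; 1; 3];
                [:: 1; 1; 2; 4]; [:: 0; 2; 3; 3]; [:: 0; 2; 1; 5];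
                [:: 1; 1; 3; 3]; [:: 3; 3; 1; 1]]].

Definition products T : seq (seq nat * seq nat) :=
  [seq (s, sort leq (times T s t)) | s <- promislow_set, t <- promislow_set].

Definition repeated_products T : bool :=
  let l := products T in
  all (fun p => has (fun q => (q.1 != p.1) && (q.2 == p.2)) l) l.

Lemma promislow_repeated T s t :
  T \in square_tables -> s \in promislow_set -> t \in promislow_set ->
  exists s' t', [/\ s' \in promislow_set, t' \in promislow_set, s' != s
    & perm_eq (times T s t) (times T s' t')].
Proof.
have : all repeated_products square_tables by vm_compute.
move=> /allP h /h/allP{}h sS tS.
have /h/hasP[_ /allpairsP[[s' t'] /= [s'S t'S ->]] /= /andP[ne /eqP e]] :
  (s, sort leq (times T s t)) \in products T by apply/allpairsP; exists (s, t).
exists s', t'; split=> //.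
by rewrite -(perm_sort leq) -e perm_sort.
Qed.

Lemma promislow_letters s : s \in promislow_set -> all (gtn 4) s.
Proof. by have /allP : all (all (gtn 4)) promislow_set by []; apply. Qed.

Lemma promislow_perm s t : s \in promislow_set -> t \in promislow_set ->
  perm_eq s t -> s = t.
Proof.
have /allP h : all (sorted leq) promislow_set by [].
by move=> /h ss /h st; apply: (sorted_eq leq_trans anti_leq ss st).
Qed.

Lemma times_div T s t : T \in square_tables ->
  s \in promislow_set -> t \in promislow_set ->
  exists2 u, times T s t = s ++ u & map (lift_map (entry T) id s) u = t /\ all (gtn 4) u.
Proof.
move=> TT sS tS; eexists; first by [].
have : all (fun T => all (fun s => all (fun t =>
    let u := drop (size s) (times T s t) in
    (map (lift_map (entry T) id s) u == t) && all (gtn 4) u)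
  promislow_set) promislow_set) square_tables by vm_compute.
move=> /allP/(_ T TT)/allP/(_ s sS)/allP/(_ t tS).
by rewrite /times drop_size_cat // => /andP[/eqP].
Qed.

Section Square.
Variables (X : choiceType) (r : X * X -> X * X).
Hypothesis solr : is_involutive_solution r.

(** The images [g s] of the elements of the set are pairwise distinct, and each
of their products has a second factorization with another left factor. *)
Lemma square_not_unique_product :
  contains_square (sigma r) -> ~ unique_product (structure_group r).
Proof.
have [psi [psiK sK law _]] := solution_psi solr.
case=> T [w [TT wI wT]] up.
have wpsi i j : i < 4 -> j < 4 -> psi (w i) (w j) = w (entry T i j).
  by move=> i4 j4; rewrite -(wT i j i4 j4) sK.
have lift_w s (a : X -> X) (b : nat -> nat) : all (gtn 4) s ->
    (forall i, i < 4 -> a (w i) = w (b i) /\ b i < 4) ->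
    forall i, i < 4 -> lift_map psi a (map w s) (w i) = w (lift_map (entry T) b s i).
  elim: s a b => /= [|x s IHs] a b; first by move=> _ ab i /ab[].
  move=> /andP[x4 s4] ab; apply: IHs => // i i4 /=.
  have [-> bx4] := ab x x4; have [-> bi4] := ab i i4.
  by split; [apply: wpsi | case: (square_columns TT bx4 bi4)].
pose g s := positive_class r psi (map w s).
have gM s t : s \in promislow_set -> t \in promislow_set ->
    (g s * g t)%g = g (times T s t).
  move=> sS tS; have [u -> [ut u4]] := times_div TT sS tS.
  rewrite /g map_cat -positive_classM; congr (_ * positive_class _ _ _)%g.
  rewrite -{1}ut -!map_comp; apply/eq_in_map => i /(allP u4) i4 /=.
  by rewrite (lift_w s id id) ?promislow_letters.
have g_inj s t : s \in promislow_set -> t \in promislow_set -> g s = g t -> s = t.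
  move=> sS tS gst; apply: promislow_perm => //.
  have count_w z u : z < 4 -> all (gtn 4) u -> count_mem (w z) (map w u) = count_mem z u.
    move=> z4 /allP u4; rewrite count_map; apply: eq_in_count => i /u4 i4 /=.
    by apply/eqP/eqP=> [/wI|->//]; apply.
  have s4 := promislow_letters sS; have t4 := promislow_letters tS.
  apply/allP=> z; rewrite mem_cat => zst.
  have z4 : z < 4 by case/orP: zst => [/(allP s4)|/(allP t4)].
  have := count_positive_class solr psiK sK law (w z) gst.
  by rewrite !count_w // => /eqP.
pose A : {fset structure_group r} := [fset x in map g promislow_set]%fset.
have AP x : reflect (exists2 s, s \in promislow_set & x = g s) (x \in A).
  by rewrite in_fset; apply: mapP.
have A0 : A != fset0.
  by apply/fset0Pn; exists (g (head [::] promislow_set)); apply/AP; eexists; last by [].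
have [x [p [[p1A p2A xE] puniq]]] := up A A A0 A0.
have /AP[s sS sE] := p1A; have /AP[t tS tE] := p2A.
have [s' [t' [s'S t'S ne e]]] := promislow_repeated TT sS tS.
have /(congr1 fst)/= : p = (g s', g t').
  apply: puniq; split; [by apply/AP; exists s' | by apply/AP; exists t' |].
  rewrite xE sE tE /= !gM //.
  by apply: positive_class_perm => //; apply: perm_map.
by rewrite sE => /(g_inj _ _ sS s'S) es; rewrite es eqxx in ne.
Qed.
End Square.

(** * Conclusion *)

Lemma search_succeeds k : 0 < k < 7 -> every_table_has_square k.+1.
Proof.
case: k => [|[|[|[|[|[|[|k]]]]]]] bound; try exact: (False_ind _ (notF bound)).
all: vm_cast_no_check (erefl true).
Qed.

Theorem proposition3p6 (X : finType) (r : X * X -> X * X) :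
  is_involutive_solution r ->
  #|X| <= 7 ->
  ~ multipermutation r ->
  ~ unique_product (structure_group r).
Proof.
move=> solr X7 nmulti; apply: square_not_unique_product => //.
apply: (@tower_square search_succeeds _ (QSet r) enum_val) => //.
- exact: enum_val_bij.
- exact: X7.
move=> n one; apply: nmulti; case: n one => [[x xP] | n one]; last by exists n.+1.
exists 1; split=> //; exists (@ret_class (QSet r) x) => a.
by have [y <-] := ret_class_surj a; rewrite (xP y).
Qed.
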